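(* Let $X_{L,Q,M_0}$ be a time-independent nonholonomic system with affine constraints, with regular Lagrangian $L:TQ\to\mathbb{R}$ and with constraint submanifold $M_0\subset TQ$ corresponding to the affine distribution $\mathcal{M}_0=\xi_0+\mathcal{D}_0$ on $Q$. Let $\Psi:G\times Q\to Q$ be an action of a Lie group $G$ on $Q$, with Lie algebra $\mathfrak{g}$, and let $\Psi^{TQ}_g(v_q)=T_q\Psi_g\cdot v_q$ be its tangent lift. Assume that: (H1) $L\circ\Psi^{TQ}_g=L$ for all $g\in G$; (H2) $(\mathcal{D}_0)_{\Psi_g(q)}=T_q\Psi_g\cdot(\mathcal{D}_0)_q$ for all $g\in G$ and $q\in Q$; (H3) $\eta\in\mathfrak{g}$ is such that $Y_\eta-\xi_0$ is a section of $\mathcal{D}_0$, where $Y_\eta:=\frac{d}{dt}\Psi_{\exp(t\eta)}|_{t=0}$ is the infinitesimal generator of the one-parameter subgroup generated by $\eta$. Then the moving energy $E^*_{L,\mathcal{C}_\eta,M_0}$, that is, the restriction to $M_0$ of the function $E^*_{L,\mathcal{C}_\eta}=E_L-J_\eta$ with $J_\eta=\langle p,Y_\eta\rangle$, is a time-independent first integral of $X_{L,Q,M_0}$.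
   Context: All manifolds and maps are smooth and all vector fields are assumed complete. Time-independent nonholonomic system with affine constraints. $Q$ is an $n$-dimensional manifold and $L:TQ\to\mathbb{R}$ is a regular Lagrangian, i.e. in all bundle coordinates $(q,\dot q)$ the matrix $\frac{\partial^2L}{\partial\dot q\,\partial\dot q}$ is everywhere invertible. $\mathcal{D}_0$ is a nonintegrable distribution on $Q$ of constant rank $r$, $1<r<n$, and $\xi_0$ is a vector field on $Q$. They define the affine distribution $\mathcal{M}_0=\xi_0+\mathcal{D}_0$ with fibers $(\mathcal{M}_0)_q=\{v_q\in T_qQ: v_q-\xi_0(q)\in(\mathcal{D}_0)_q\}$; $\mathcal{D}_0$ is determined by $\mathcal{M}_0$ and $\xi_0$ is determined up to a section of $\mathcal{D}_0$. The constraint submanifold is the affine subbundle $M_0=\{v_q : q\in Q,\ v_q\in(\mathcal{M}_0)_q\}$ of $TQ$. The constraint is ideal (d'Alembert): reaction forces at $q$ lie in the annihilator $(\mathcal{D}_0)_q^\circ\subset T_q^*Q$. There is a unique function $R_{L,M_0}:M_0\to\mathcal{D}_0^\circ$ (over the identity of $Q$) such that the restriction to $M_0$ of the Lagrange equations with reaction force, $\frac{d}{dt}\frac{\partial L}{\partial\dot q}-\frac{\partial L}{\partial q}=R_{L,M_0}$, defines a vector field on $M_0$; this vector field is $X_{L,Q,M_0}$ (existence and uniqueness of $R_{L,M_0}$ are taken as part of the setting). Energy and moving energy. The energy of $L$ is $E_L(v_q)=\langle p(v_q),v_q\rangle-L(v_q)$, with $p$ the momentum covector; in coordinates $p=\frac{\partial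 L}{\partial\dot q}$ and $E_L=\dot q\cdot\frac{\partial L}{\partial\dot q}-L$. For a time-dependent diffeomorphism $\mathcal{C}(q,t)=(\mathcal{Q}(q,t),t)$ of $Q\times\mathbb{R}$ to itself (each $\mathcal{Q}_t=\mathcal{Q}(\cdot,t)$ being a diffeomorphism), its lift is $D\mathcal{C}(v_q,t)=\big(T_q\mathcal{Q}_t\cdot v_q+\frac{\partial\mathcal{Q}}{\partial t}(q,t),t\big)$ on $TQ\times\mathbb{R}$, and the moving energy induced by $\mathcal{C}$ is the restriction to the constraint submanifold of $E^*_{L,\mathcal{C}}:=E_{L\circ D\mathcal{C}}\circ D\mathcal{C}^{-1}$ (functions on $TQ$ are identified with functions on $TQ\times\mathbb{R}$ constant in $t$; the energy of a time-dependent Lagrangian is defined by the same formula at each fixed $t$). Here $\mathcal{C}_\eta=(\Phi^{Y_\eta},\mathrm{id}_{\mathbb{R}})$, where $\Phi^{Y_\eta}:Q\times\mathbb{R}\to Q$, $\Phi^{Y_\eta}(q,t)=\Psi_{\exp(t\eta)}(q)$, is the flow of $Y_\eta$; in this case $E^*_{L,\mathcal{C}_\eta}=E_L-J_\eta$. *)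

(* Defs.v *)
From HB Require Import structures.
From mathcomp Require Import all_boot all_order all_algebra.
From mathcomp Require Import all_classical all_reals all_analysis.

Set Implicit Arguments.
Unset Strict Implicit.
Unset Printing Implicit Defensive.

Import Order.TTheory GRing.Theory Num.Theory.
Import numFieldNormedType.Exports.

Local Open Scope classical_set_scope.
Local Open Scope ring_scope.

Section Smooth.
Variables (R : realType) (E F : normedModType R).

(* [U] is always an open set below.  In finite dimension this is the usual
   class C^k, stated with directional derivatives. *)
Fixpoint Ck (k : nat) (U : set E) (f : E -> F) : Prop :=
  if k is k'.+1 then
    (forall x, U x -> differentiable f x) /\
    (forall v : E, Ck k' U (fun x => 'D_v f x))
  else forall x, U x -> {for x, continuous f}.

Definition smooth_on (U : set E) (f : E -> F) : Prop := forall k, Ck k U f.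

End Smooth.

(* Charts [coord i : T -> E] with domain [dom i] and inverse [param i]; values
   outside the domains are irrelevant.  [chart_at p] is a chosen chart around
   [p].  The tangent space at [p] is the model space [E], a vector being
   represented by its components in the chart [chart_at p]. *)
Record atlas (R : realType) (E : normedModType R) (T : Type) := Atlas {
  chart : Type;
  dom : chart -> set T;
  coord : chart -> T -> E;
  param : chart -> E -> T;
  chart_at : T -> chart }.

Record manifold (R : realType) (E : normedModType R) := Manifold {
  points :> topologicalType;
  charts :> atlas E points;
  manifold_hausdorff : hausdorff_space points;
  manifold_second_countable : @second_countable points;
  mem_chart_at : forall p, dom (chart_at charts p) p;
  open_dom : forall i : chart charts, open (dom i);
  open_coord : forall i : chart charts, open (coord i @` dom i);
  coordK : forall (i : chart charts) p, dom i p -> param i (coord i p) = p;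
  coord_continuous : forall i : chart charts,
    {within dom i, continuous (coord i)};
  param_continuous : forall i : chart charts,
    {within coord i @` dom i, continuous (param i)};
  transition_smooth : forall i j : chart charts,
    smooth_on (coord i @` (dom i `&` dom j)) (coord j \o param i) }.

Section Constructions.
Variable R : realType.

Definition self_atlas (E : normedModType R) : atlas E E :=
  Atlas (fun _ : unit => setT) (fun _ => id) (fun _ => id) (fun _ => tt).

Definition prod_atlas (E F : normedModType R) (S T : Type)
    (A : atlas E S) (B : atlas F T) : atlas (E * F)%type (S * T)%type :=
  Atlas (fun i : chart A * chart B => dom i.1 `*` dom i.2)
        (fun i p => (coord i.1 p.1, coord i.2 p.2))
        (fun i x => (param i.1 x.1, param i.2 x.2))
        (fun p => (chart_at A p.1, chart_at B p.2)).

(* The tangent bundle, with points [(q, v)], [v] in T_qQ.  The chart [i] of the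
   base induces the bundle coordinates (q, qdot) associated with [i]. *)
Definition tangent_atlas (E : normedModType R) (T : Type) (A : atlas E T) :
    atlas (E * E)%type (T * E)%type :=
  Atlas (fun (i : chart A) v => dom i v.1)
        (fun i v => let j := chart_at A v.1 in
           (coord i v.1, 'd (coord i \o param j) (coord j v.1) v.2))
        (fun i z => let x : E := z.1 in let p := param i x in
           (p, 'd (coord (chart_at A p) \o param i) x z.2))
        (fun v => chart_at A v.1).

End Constructions.

Section Maps.
Variables (R : realType) (E F : normedModType R) (S T : Type).
Variables (A : atlas E S) (B : atlas F T).

Definition smooth_at (f : S -> T) (p : S) : Prop :=
  forall (i : chart A) (j : chart B), dom i p -> dom j (f p) ->
  exists U : set E, [/\ open U, U (coord i p),
    U `<=` coord i @` (dom i `&` f @^-1` dom j) &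
    smooth_on U (coord j \o f \o param i)].

Definition smooth_map (f : S -> T) : Prop := forall p, smooth_at f p.

Definition tangent_map (f : S -> T) (p : S) : E -> F :=
  let i := chart_at A p in
  'd (coord (chart_at B (f p)) \o f \o param i) (coord i p).

Definition tangent_lift (f : S -> T) (v : S * E) : T * F :=
  (f v.1, tangent_map f v.1 v.2).

End Maps.

Section VectorFields.
Variables (R : realType) (E : normedModType R) (T : Type) (A : atlas E T).

Definition velocity (c : R -> T) (t : R) : E :=
  derive1 (coord (chart_at A (c t)) \o c) t.

Definition smooth_curve : (R -> T) -> Prop := smooth_map (self_atlas R^o) A.

Definition section_smooth_at (X : T -> E) (p : T) : Prop :=
  smooth_at A (tangent_atlas A) (fun q => (q, X q)) p.

Definition tangent_to (S : set T) (p : T) (w : E) : Prop :=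
  exists c : R -> T,
    [/\ smooth_curve c, c 0 = p, forall t, S (c t) & velocity c 0 = w].

(* A smooth vector field on the submanifold [S].  Only the values of [X] on [S]
   matter, and smoothness is the existence of local smooth extensions: [Y] is
   unconstrained away from [p], except that it agrees with [X] on [S]. *)
Definition vector_field_on (S : set T) (X : T -> E) : Prop :=
  forall p, S p -> tangent_to S p (X p) /\
    exists Y : T -> E, section_smooth_at Y p /\ forall q, S q -> Y q = X q.

Definition integral_curve (S : set T) (X : T -> E) (I : set R) (c : R -> T) :
    Prop :=
  forall t, I t -> [/\ smooth_at (self_atlas R^o) A c t, S (c t) &
                      velocity c t = X (c t)].

Definition complete_on (S : set T) (X : T -> E) : Prop :=
  forall p, S p -> exists c, integral_curve S X setT c /\ c 0 = p.

Definition first_integral (S : set T) (X : T -> E) (f : T -> R) : Prop :=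
  forall (I : set R) (c : R -> T), open I -> is_interval I ->
  integral_curve S X I c -> forall s t, I s -> I t -> f (c s) = f (c t).

End VectorFields.

Record lie_group (R : realType) (m : nat) := LieGroup {
  gman :> manifold 'rV[R]_m;
  gmul : gman -> gman -> gman;
  gone : gman;
  ginv : gman -> gman;
  gmulA : associative gmul;
  gmul1 : left_id gone gmul;
  gmulV : left_inverse gone ginv gmul;
  gmul_smooth : smooth_map (prod_atlas gman gman) gman (fun x => gmul x.1 x.2);
  ginv_smooth : smooth_map gman gman ginv }.

Section Actions.
Variables (R : realType) (m : nat) (G : lie_group R m).

(* The Lie algebra is T_1 G, i.e. 'rV_m.  This determines [exp] uniquely. *)
Definition is_exp (exp : 'rV[R]_m -> G) : Prop :=
  forall xi, let gamma (t : R) := exp (t *: xi) in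
  [/\ smooth_curve G gamma, gamma 0 = gone G,
      forall s t, gamma (s + t) = gmul (gamma s) (gamma t) &
      velocity G gamma 0 = xi].

Definition is_action n (Q : manifold 'rV[R]_n) (Psi : G -> Q -> Q) : Prop :=
  [/\ forall q, Psi (gone G) q = q,
      forall g h q, Psi (gmul g h) q = Psi g (Psi h q) &
      smooth_map (prod_atlas G Q) Q (fun x => Psi x.1 x.2)].

Definition infinitesimal_generator n (Q : manifold 'rV[R]_n)
    (exp : 'rV[R]_m -> G) (Psi : G -> Q -> Q) (eta : 'rV[R]_m) (q : Q) :
    'rV[R]_n :=
  velocity Q (fun t => Psi (exp (t *: eta)) q) 0.

End Actions.

Section Distributions.
Variables (R : realType) (n : nat) (Q : manifold 'rV[R]_n).
Implicit Type D : Q -> {vspace 'rV[R]_n}.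

Definition smooth_distribution (r : nat) D : Prop :=
  forall q, \dim (D q) = r /\
  exists e : 'I_r -> Q -> 'rV[R]_n,
    (forall k, section_smooth_at Q (e k) q) /\
    \forall p \near q, D p = <<[seq e k p | k : 'I_r]>>%VS.

(* Through every point there passes an integral manifold, parametrized by a
   neighbourhood of 0 in R^r.  If [D] has rank [r] then [s] is an immersion. *)
Definition integrable_distribution (r : nat) D : Prop :=
  forall q, exists s : 'rV[R]_r -> Q, s 0 = q /\
  \forall u \near (0 : 'rV[R]_r),
    smooth_at (self_atlas 'rV[R]_r) Q s u /\
    range (tangent_map (self_atlas 'rV[R]_r) Q s u) = [set` D (s u)].

End Distributions.

Section Lagrangian.
Variables (R : realType) (n : nat) (Q : manifold 'rV[R]_n).
Local Notation E := 'rV[R]_n.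
Local Notation TQ := (Q * E)%type.
Implicit Types (L : TQ -> R) (v : TQ) (xi : Q -> E) (D : Q -> {vspace E}).

Definition smooth_lagrangian L : Prop :=
  smooth_map (tangent_atlas Q) (self_atlas R^o) L.

(* [L] in the bundle coordinates (q, qdot) of the chart [i]. *)
Definition local_lagrangian L (i : chart Q) : (E * E)%type -> R^o :=
  L \o @param _ _ _ (tangent_atlas Q) i.

(* Invertibility of the Hessian in the charts of the atlas is equivalent to its
   invertibility in all bundle coordinates. *)
Definition regular_lagrangian L : Prop :=
  forall (i : chart Q) v, dom i v.1 ->
  let z := @coord _ _ _ (tangent_atlas Q) i v in
  (\matrix_(a < n, b < n)
     'D_((0, delta_mx 0 a) : E * E) (fun y =>
       'D_((0, delta_mx 0 b) : E * E) (local_lagrangian L i) y) z)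
  \in unitmx.

(* <p(v), u>, with p the fibre derivative of [L]: p = dL/dqdot in coordinates. *)
Definition momentum L v (u : E) : R :=
  'D_u (fun w : E => L (v.1, w) : R^o) v.2.

Definition energy L v : R := momentum L v v.2 - L v.

(* The covector d/dt (dL/dqdot) - dL/dq evaluated on [u], where d/dt is the
   derivative along the tangent vector [w] to TQ at [v]; in the bundle
   coordinates of the chart [chart_at v.1]. *)
Definition lagrange_expression L v (w : E * E) (u : E) : R :=
  let i := chart_at Q v.1 in
  let z := @coord _ _ _ (tangent_atlas Q) i v in
  'D_w (fun y => 'D_((0, u) : E * E) (local_lagrangian L i) y) z
  - 'D_((u, 0) : E * E) (local_lagrangian L i) z.

Definition constraint xi D : set TQ := [set v | v.2 - xi v.1 \in D v.1].

Definition annihilates (a : E -> R^o) (V : {vspace E}) : Prop :=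
  forall u, u \in V -> a u = 0.

(* The restriction to the constraint submanifold of the Lagrange equations with
   the ideal reaction force [Rf] defines the vector field [X] on it. *)
Definition lagrange_with_reaction L xi D
    (Rf : TQ -> {linear E -> R^o}) (X : TQ -> (E * E)%type) : Prop :=
  vector_field_on (tangent_atlas Q) (constraint xi D) X /\
  forall v, constraint xi D v ->
    [/\ annihilates (Rf v) (D v.1), (X v).1 = v.2 &
        forall u, lagrange_expression L v (X v) u = Rf v u].

(* [Rf] is the unique reaction force for which such a vector field exists. *)
Definition nonholonomic_vector_field L xi D (X : TQ -> (E * E)%type) : Prop :=
  exists2 Rf, lagrange_with_reaction L xi D Rf X &
    forall Rf' X', lagrange_with_reaction L xi D Rf' X' ->
    forall v, constraint xi D v -> Rf' v =1 Rf v.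

(* The lift at time [t] of the time-dependent diffeomorphism
   (q, t) |-> (C q t, t). *)
Definition time_lift (C : Q -> R -> Q) (t : R) v : TQ :=
  (C v.1 t, tangent_map Q Q (C^~ t) v.1 v.2 + velocity Q (C v.1) t).

(* E_{L o DC} o DC^-1 at [(v, t)]. *)
Definition moving_energy L (C : Q -> R -> Q) v (t : R) : R :=
  energy (L \o time_lift C t) ('pinv_id setT (time_lift C t) v).

End Lagrangian.

(* Main.v *)
Require Import Defs.
From HB Require Import structures.
From mathcomp Require Import all_boot all_order all_algebra.
From mathcomp Require Import all_classical all_reals all_analysis.

Set Implicit Arguments.
Unset Strict Implicit.
Unset Printing Implicit Defensive.

Import Order.TTheory GRing.Theory Num.Theory.
Import numFieldNormedType.Exports.

Local Open Scope classical_set_scope.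
Local Open Scope ring_scope.

(* Noether's argument, applied to the relative velocity. Energy minus J_eta is
   [p(v).(v - Y) - L(v)], so along a motion its derivative is the covector
   d/dt(dL/dqdot) - dL/dq evaluated at [v - Y], minus the derivative of [L]
   along the tangent lift of [Y]. The latter vanishes by invariance, and the
   former is the value of the reaction force on
   [v - Y = (v - xi0) - (Y - xi0)], a vector of D0, hence it vanishes too.
   The formula for the moving energy only uses that the fibre derivative of [L]
   is linear and that the lift of the flow maps [(q, u)] to
   [(Psi q, T Psi u + Y)]. *)

(** * Differential calculus *)

Section Calculus.
Context {R : realType}.
Implicit Types V W : normedModType R.

(** A differential depends only on the germ: the first-order expansion of [f] at [a] is also one of
    [g], and expansions are unique. *)
Lemma near_eq_is_diff V W (f g df : V -> W) (a : V) :
  (\near a, f a = g a) -> is_diff a f df -> is_diff a g df.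
Proof.
move=> fg [fd <-]; have ga : g a = f a by rewrite (nbhs_singleton fg).
have E : g \o shift a = cst (g a) + 'd f a +o_ 0 id.
  apply/eqaddoP => e e0.
  have /eqaddoP/(_ e e0) := diff_locally fd.
  have fg0 : \forall x \near (0 : V), f (x + a) = g (x + a).
    by have := fg; rewrite (near_shift 0) /= subr0.
  by apply: filterS2 fg0 => x /= fgx; rewrite !fctE /= -fgx ga.
have dE : 'd g a = 'd f a :> (V -> W).
  by apply: diff_unique E; exact: diff_continuous.
apply: DiffDef => //; apply/diff_locallyP.
by rewrite dE; split => //; exact: diff_continuous.
Qed.

Lemma is_diff_derive V W (f df : V -> W) (a v : V) :
  is_diff a f df -> 'D_v f a = df v.
Proof. by move=> fa; rewrite deriveE// diff_val. Qed.

Lemma is_diff_curve W (f : R -> W) (t : R) (l : W) :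
  is_derive t 1 f l -> is_diff t f ( *:%R^~ l).
Proof.
move=> [/derivable1_diffP fd <-].
by apply: DiffDef => //; rewrite deriv1E ?derive1E//; exact/derivable1_diffP.
Qed.

Lemma is_derive_comp_curve V W (f df : V -> W) (c : R -> V) (t : R) (l : V) :
  is_derive t 1 c l -> is_diff (c t) f df -> is_derive t 1 (f \o c) (df l).
Proof.
move=> /is_diff_curve cl fd.
have h : is_diff t (f \o c) (df \o *:%R^~ l) by exact: is_diff_comp.
apply: DeriveDef; first exact/derivable1_diffP.
by rewrite (is_diff_derive _ h)/= scale1r.
Qed.

Lemma derive1_shift V (f : R -> V) (t : R) :
  derive1 f t = derive1 (fun s => f (s + t)) 0.
Proof.
have E : (fun h : R => h^-1 *: (f (h + t) - f t)) =
    (fun h => h^-1 *: (f (h + 0 + t) - f (0 + t))).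
  by apply/funext => h; rewrite addr0 add0r.
by rewrite /derive1 E.
Qed.

(** The mean value theorem is scalar, so it is applied to the coordinate [j] of [f] along a segment;
    the intermediate point depends on [j]. *)
Lemma MVT_coord V n (f : V -> 'rV[R]_n) (a u : V) (t : R) j : 0 < t ->
  (forall s : R, s \in `[0, t] -> differentiable f (a + s *: u)) ->
  exists2 s, s \in `]0, t[ &
    (f (a + t *: u) - f a) 0 j = t * 'D_u f (a + s *: u) 0 j.
Proof.
move=> t0 fd.
pose c s := a + s *: u.
have cd (s : R) : is_derive s (1 : R) c u.
  apply: DeriveDef; first exact/derivable1_diffP.
  have h : is_diff s c (0 + *:%R^~ u) by exact: is_diffD.
  by rewrite (is_diff_derive _ h) !fctE add0r scale1r.
pose g s := f (c s) 0 j.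
have gd (s : R) : s \in `[0, t] -> is_derive s 1 g ('D_u f (c s) 0 j).
  move=> /fd; rewrite -/(c s) => fcs.
  have fc : is_derive s 1 (f \o c) ('D_u f (c s)).
    by rewrite deriveE//; apply: is_derive_comp_curve.
  have [fcd <-] := fc.
  apply: DeriveDef; first exact: (derivable_mxP _ _ _).1 fcd 0 j.
  by rewrite derive_mx// mxE.
have dg (s : R) : s \in `]0, t[ -> is_derive s (1 : R) g ('D_u f (c s) 0 j).
  by move=> sI; apply: gd; exact: subset_itv_oo_cc.
have cg : {within `[0, t], continuous g}.
  apply: derivable_within_continuous => x xI.
  by have [] := gd _ xI.
have [s sI] := MVT t0 dg cg.
rewrite subr0 mulrC => E; exists s => //.
by rewrite -E /g /c scale0r addr0 !mxE.
Qed.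

(** Point and direction both move. Expanding the direction in the standard basis gives a finite sum
    of products of a coordinate of [u] and a partial derivative [p j] along [z], to which the
    product rule applies. *)
Lemma is_derive_dir_curve V n (f : V -> R^o) (e : {linear 'rV[R]_n -> V})
    (z : R -> V) (u : R -> 'rV[R]_n) (t : R) (dz : V) (du : 'rV[R]_n) :
  (\forall x \near z t, differentiable f x) ->
  (forall v, differentiable (fun x => 'D_v f x) (z t)) ->
  is_derive t (1 : R) z dz -> is_derive t (1 : R) u du ->
  is_derive t (1 : R) (fun s => 'D_(e (u s)) f (z s))
    ('D_dz (fun x => 'D_(e (u t)) f x) (z t) + 'D_(e du) f (z t)).
Proof.
move=> fd fd2 zdz ud; have [zd _] := zdz.
have zt : z @ t --> z t.
  by apply: differentiable_continuous; exact/derivable1_diffP.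
have fzd : \forall s \near t, differentiable f (z s) by exact: (zt _ fd).
pose p j (x : V) : R := 'D_(e (delta_mx 0 j)) f x.
have fE x w : differentiable f x -> 'D_(e w) f x = \sum_j w 0 j * p j x.
  move=> fx; rewrite deriveE// {1}[w]row_sum_delta !linear_sum.
  by apply: eq_bigr => j _; rewrite !linearZ/= /p deriveE.
have pd j : is_diff (z t) (p j) ('d (p j) (z t)).
  by apply: differentiableP; exact: fd2.
have ujd j : is_derive t (1 : R) (fun s => u s 0 j) (du 0 j).
  have [ud' <-] := ud.
  apply: DeriveDef; first exact: (derivable_mxP _ _ _).1 ud' 0 j.
  by rewrite derive_mx// mxE.
have pzd j : is_derive t (1 : R) (p j \o z) ('d (p j) (z t) dz).
  exact: is_derive_comp_curve.
apply: near_eq_is_derive (_ : is_derive t 1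
   (\sum_j (fun s => u s 0 j) * (p j \o z)) _).
  near=> s; rewrite fE; last by near: s.
  by rewrite fct_sumE.
apply: is_derive_eq.
rewrite fE; last exact: (nbhs_singleton fzd).
rewrite big_split/=; congr (_ + _); last first.
  by apply: eq_bigr => j _; rewrite mulrC.
have E : \forall x \near z t,
    'D_(e (u t)) f x = (\sum_j (u t 0 j *: p j)) x.
  by near=> x; rewrite fE ?fct_sumE//; near: x.
rewrite (near_eq_derive _ E) derive_sum => [|j]; last first.
  exact/derivableZ/diff_derivable.
apply: eq_bigr => j _; rewrite deriveZ ?deriveE//; exact: diff_derivable.
Unshelve. all: by end_near. Qed.

Lemma derive0_itv_cst (I : set R) (f : R -> R) : is_interval I ->
  (forall t, I t -> is_derive t (1 : R) f 0) ->
  forall s t, I s -> I t -> f s = f t.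
Proof.
move=> Iitv f0.
have H s t : s < t -> I s -> I t -> f s = f t.
  move=> st Is It.
  have Ix x : x \in `[s, t] -> I x.
    by rewrite in_itv/=; exact: Iitv Is It x.
  have df (x : R) : x \in `]s, t[ -> is_derive x (1 : R) f ((fun=> 0) x).
    by move=> /subset_itv_oo_cc/Ix/f0.
  have cf : {within `[s, t], continuous f}.
    by apply: derivable_within_continuous => x /Ix/f0[].
  have [x _] := MVT st df cf.
  by rewrite mul0r => /subr0_eq.
move=> s t Is It; case: (ltgtP s t) => [st|ts|->//]; first exact: H.
by apply/esym/H.
Qed.

(** Two uses of the mean value theorem: along [u] for the increment [phi] of [f] in direction [v],
    then along [v] for ['D_u f]. *)
Lemma second_difference V n (f : V -> 'rV[R]_n) (U : set V) (a u v : V)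
    (t : R) j : 0 < t -> Ck 2 U f ->
  (forall s s' : R, s \in `[0, t] -> s' \in `[0, t] ->
     U (a + s *: u + s' *: v)) ->
  exists s s' : R, [/\ s \in `[0, t], s' \in `[0, t] &
    (f (a + t *: u + t *: v) - f (a + t *: u) - (f (a + t *: v) - f a)) 0 j =
    t * (t * 'D_v (fun x => 'D_u f x) (a + s *: u + s' *: v) 0 j)].
Proof.
move=> t0 [fd f2] aU.
have t0t : (0 : R) \in `[0, t] by rewrite in_itv/= lexx ltW.
have ttt : t \in `[0, t] by rewrite in_itv/= lexx ltW.
have fdt s s' : s \in `[0, t] -> s' \in `[0, t] ->
    differentiable f (a + s *: u + s' *: v).
  by move=> *; apply/fd/aU.
have fd0 (s : R) : s \in `[0, t] -> differentiable f (a + s *: u).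
  by move=> sI; rewrite -[_ + _]addr0 -(scale0r v); exact: fdt.
pose phi (x : V) := f (x + t *: v) - f x.
have sh (s : R) : s \in `[0, t] ->
    is_diff (a + s *: u) (f \o +%R^~ (t *: v))
      ('d f (a + s *: u + t *: v)).
  move=> sI.
  have h1 : is_diff (a + s *: u) (fun x : V => x + t *: v) (id + 0).
    exact: is_diffD.
  rewrite addr0 in h1.
  have h2 := differentiableP (fdt _ _ sI ttt).
  exact: (is_diff_comp h1 h2).
have phid (s : R) : s \in `[0, t] ->
    is_diff (a + s *: u) phi
      (fun w => 'd f (a + s *: u + t *: v) w - 'd f (a + s *: u) w).
  move=> sI.
  have h1 := sh _ sI.
  have h2 := differentiableP (fd0 _ sI).
  exact: (is_diffB h1 h2).
have [|s sI E] := @MVT_coord _ _ phi a u t j t0.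
  by move=> s /phid[].
have {}sI := subset_itv_oo_cc sI.
rewrite -/(phi (a + t *: u)) -/(phi a) E.
rewrite (is_diff_derive _ (phid _ sI)).
have [|s' s'I E'] := @MVT_coord _ _ (fun x => 'D_u f x) (a + s *: u) v t j t0.
  by move=> s' s'I; apply: (f2 u).1; exact: aU.
exists s, s'; split => //; first exact: subset_itv_oo_cc.
rewrite -E'; congr (_ * _).
by rewrite !deriveE//; [exact: fd0|exact: fdt].
Qed.

(** The second difference is symmetric in [u] and [v], and it is the square of [t] times either
    mixed derivative at points near [a]. By continuity the two mixed derivatives at [a] differ by at
    most any [e > 0]. *)
Lemma schwarz V n (f : V -> 'rV[R]_n) (U : set V) (a u v : V) :
  open U -> U a -> Ck 2 U f ->
  'D_u (fun x => 'D_v f x) a = 'D_v (fun x => 'D_u f x) a.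
Proof.
move=> oU Ua f2; have := f2 => -[fd f1].
apply/rowP => j; apply/eqP; rewrite -subr_eq0 -normr_le0.
apply/ler_addgt0Pr => e e0; rewrite add0r.
pose near_val (g : V -> 'rV[R]_n) : set V :=
  [set x | `|g x 0 j - g a 0 j| < e / 2].
have nearP (g : V -> 'rV[R]_n) : {for a, continuous g} ->
    nbhs a (near_val g).
  move=> ga.
  have gj : (fun x => g x 0 j) @ a --> g a 0 j.
    exact: (continuous_comp ga (@coord_continuous _ _ _ 0 j _)).
  by move/cvgrPdistC_lt: gj => /(_ (e / 2)); apply; rewrite divr_gt0.
have nU : nbhs a U by exact: open_nbhs_nbhs.
have nuv : nbhs a (near_val ('D_u ('D_v f))).
  exact: nearP _ ((f1 v).2 u a Ua).
have nvu : nbhs a (near_val ('D_v ('D_u f))).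
  exact: nearP _ ((f1 u).2 v a Ua).
have /nbhs_ballP[d /= d0 dP] : nbhs a
    (U `&` (near_val ('D_u ('D_v f)) `&` near_val ('D_v ('D_u f)))).
  by apply: filterI => //; exact: filterI.
have uv0 : 0 < `|u| + `|v| + 1 by rewrite ltr_wpDl// addr_ge0.
(* This size keeps the parallelogram spanned by [t *: u] and [t *: v] inside the ball of radius [d];
   the summand 1 covers [u = v = 0]. *)
pose t := d / (`|u| + `|v| + 1).
have t0 : 0 < t by rewrite divr_gt0.
have inb (s s' : R) : s \in `[0, t] -> s' \in `[0, t] ->
    ball a d (a + s *: u + s' *: v).
  rewrite !in_itv/= => /andP[s0 st] /andP[s'0 s't].
  rewrite -ball_normE/= distrC -[a + _ + _]addrA [a + _]addrC addrK.
  rewrite (le_lt_trans (ler_normD _ _))// !normrZ !ger0_norm//.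
  rewrite (@le_lt_trans _ _ (t * (`|u| + `|v|)))//.
    by rewrite mulrDr lerD// ler_wpM2r.
  rewrite /t -mulrA gtr_pMr// mulrC ltr_pdivrMr// mul1r.
  by rewrite ltrDl.
have [|s [s' [sI s'I E]]] := @second_difference _ _ f U a u v t j t0 f2.
  by move=> s s' sI s'I; have [] := dP _ (inb _ _ sI s'I).
have [|r [r' [rI r'I E']]] := @second_difference _ _ f U a v u t j t0 f2.
  move=> s1 s2 sI1 sI2; rewrite addrAC.
  by have [] := dP _ (inb _ _ sI2 sI1).
have [_ [_ h1]] := dP _ (inb _ _ sI s'I).
have [_ [+ _]] := dP _ (inb _ _ r'I rI).
rewrite addrAC => h2.
(* Both sides, times the square of [t], are the same second difference with its terms rearranged. *)
have EE : 'D_v ('D_u f) (a + s *: u + s' *: v) 0 j =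
          'D_u ('D_v f) (a + r *: v + r' *: u) 0 j.
  apply: (mulfI (lt0r_neq0 t0)); apply: (mulfI (lt0r_neq0 t0)).
  apply: (etrans (esym E) (etrans _ E')); congr (fun_of_matrix _ 0 j).
  have -> : a + t *: v + t *: u = a + t *: u + t *: v by rewrite addrAC.
  by rewrite !opprB addrACA [RHS]addrACA; congr (_ + _); rewrite addrC.
have close (x y p q : R) : x = y ->
    `|x - p| < e / 2 -> `|y - q| < e / 2 -> `|q - p| <= e.
  move=> -> yp yq; apply: (le_trans (ler_distD y q p)).
  by rewrite [e]splitr; apply: lerD; apply: ltW; [rewrite distrC|].
exact: close EE h1 h2.
Qed.

End Calculus.

(** * Charts *)

Section Charts.
Context {R : realType}.
(* The later imports shadow [coord] by the one of [vector]. *)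
Local Notation coord := Defs.coord.
Implicit Types E F W : normedModType R.

(** The inverse law is a field of [manifold], not of [atlas]; as a predicate it can also be stated
    for the bundle coordinates of [tangent_atlas]. *)
Definition coord_cancel E T (A : atlas E T) :=
  forall (i : chart A) p, dom i p -> param i (coord i p) = p.

(** The first-order content of [smooth_at]. The first conjunct keeps nearby points inside the chart
    domains, where coordinate expressions can be composed and compared. *)
Definition mdifferentiable E F S T (A : atlas E S) (B : atlas F T)
    (h : S -> T) (p : S) :=
  forall (i : chart A) (j : chart B), dom i p -> dom j (h p) ->
  (\forall x \near coord i p, (coord i @` (dom i `&` h @^-1` dom j)) x) /\
  differentiable (coord j \o h \o param i) (coord i p).

Lemma smooth_at_mdifferentiable E F S T (A : atlas E S) (B : atlas F T) h p :
  smooth_at A B h p -> mdifferentiable A B h p.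
Proof.
move=> hp i j ip jhp; have [U [oU Up sU Uh]] := hp i j ip jhp.
split; last exact: (Uh 1%N).1.
by apply: filterS sU _; exact: open_nbhs_nbhs.
Qed.

(* [phi] expresses a quantity at [h q], such as a coordinate of it. *)
Lemma is_diff_chart_comp E F W S T (A : atlas E S) (B : atlas F T)
    (i : chart A) (j : chart B) (h : S -> T) (p : S) (phi : T -> W) dphi :
  coord_cancel A -> coord_cancel B -> mdifferentiable A B h p ->
  dom i p -> dom j (h p) ->
  is_diff (coord j (h p)) (phi \o param j) dphi ->
  is_diff (coord i p) (phi \o h \o param i)
    (dphi \o 'd (coord j \o h \o param i) (coord i p)).
Proof.
move=> AK BK hp ip jhp phid; have [near_h hd] := hp i j ip jhp.
apply: (@near_eq_is_diff R E W
  ((phi \o param j) \o (coord j \o h \o param i))).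
  by apply: filterS near_h => _ [q [iq jhq] <-]; rewrite /= AK// BK.
have hd' := differentiableP hd.
apply: (@is_diff_comp _ _ _ _ _ _ _ _ _ hd').
by rewrite /= AK.
Qed.

Lemma manifold_coord_cancel E (Q : manifold E) : coord_cancel Q.
Proof. by move=> i p; exact: coordK. Qed.

(** Since the image of a chart is open, continuity of [param i] within it is continuity at
    [coord i p]. *)
Lemma near_param E (Q : manifold E) (i : chart Q) (p : Q) (V : set Q) :
  dom i p -> open V -> V p ->
  \forall x \near coord i p,
    [/\ dom i (param i x), coord i (param i x) = x & V (param i x)].
Proof.
move=> ip oV Vp.
have Di : (coord i @` dom i) (coord i p) by exists p.
have oDi : nbhs (coord i p) (coord i @` dom i).
  by apply: open_nbhs_nbhs; split => //; exact: open_coord.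
have ci : {for coord i p, continuous (param i)}.
  have := @param_continuous _ _ Q i.
  by rewrite continuous_open_subspace; [apply; rewrite inE|exact: open_coord].
have nV : nbhs (param i (coord i p)) V.
  by rewrite coordK//; exact: open_nbhs_nbhs.
have pV : \forall x \near coord i p, V (param i x) by exact: ci nV.
by apply: filterS2 oDi pV => _ [q iq <-]; rewrite coordK//; split.
Qed.

(** In coordinates [id] is a transition map, so that changes of charts become instances of the chain
    rule. *)
Lemma mdifferentiable_id E (Q : manifold E) (p : Q) :
  mdifferentiable Q Q id p.
Proof.
move=> i j ip jp; split.
  apply: filterS (near_param ip (open_dom j) jp) => x [ix xE jx].
  by exists (param i x).
by apply: (transition_smooth i j 1%N).1; exists p.
Qed.

Lemma is_diff_transition E (Q : manifold E) (i j : chart Q) (p : Q) :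
  dom i p -> dom j p ->
  is_diff (coord i p) (coord j \o param i)
    ('d (coord j \o param i) (coord i p)).
Proof.
by move=> ip jp; apply: differentiableP; have [] := mdifferentiable_id ip jp.
Qed.

Lemma diff_transition_id E (Q : manifold E) (i : chart Q) (p : Q) (u : E) :
  dom i p -> 'd (coord i \o param i) (coord i p) u = u.
Proof.
move=> ip.
have h : is_diff (coord i p) (coord i \o param i) id.
  apply: (@near_eq_is_diff _ _ _ id).
  by apply: filterS (near_param ip openT Logic.I) => x [_ /esym].
by rewrite diff_val.
Qed.

(* Covers both the composition of tangent maps and changes of charts. *)
Lemma diff_chart_comp E F E' S T T' (A : atlas E S) (B : atlas F T)
    (C : atlas E' T') (i : chart A) (j : chart B) (k : chart C)
    (h : S -> T) (f : T -> T') (p : S) u :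
  coord_cancel A -> coord_cancel B ->
  mdifferentiable A B h p -> mdifferentiable B C f (h p) ->
  dom i p -> dom j (h p) -> dom k (f (h p)) ->
  'd (coord k \o f \o param j) (coord j (h p))
    ('d (coord j \o h \o param i) (coord i p) u) =
  'd (coord k \o (f \o h) \o param i) (coord i p) u.
Proof.
move=> AK BK hp fp ip jhp kfp.
have fd := differentiableP (fp j k jhp kfp).2.
have H := is_diff_chart_comp AK BK hp ip jhp fd.
by rewrite (@diff_val _ _ _ _ _ _ _ H).
Qed.

Lemma diff_transition_comp E F S (A : atlas E S) (Q : manifold F)
    (i : chart A) (j k : chart Q) (h : S -> Q) (p : S) u :
  coord_cancel A -> mdifferentiable A Q h p ->
  dom i p -> dom j (h p) -> dom k (h p) ->
  'd (coord k \o param j) (coord j (h p))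
    ('d (coord j \o h \o param i) (coord i p) u) =
  'd (coord k \o h \o param i) (coord i p) u.
Proof.
move=> AK hp ip jhp khp.
exact: (diff_chart_comp (f := id) u AK (@manifold_coord_cancel _ Q) hp
  (@mdifferentiable_id _ Q _) ip jhp khp).
Qed.

Lemma tangent_map_comp E1 E2 E3 (Q1 : manifold E1) (Q2 : manifold E2)
    (Q3 : manifold E3) (h : Q1 -> Q2) (f : Q2 -> Q3) p u :
  mdifferentiable Q1 Q2 h p -> mdifferentiable Q2 Q3 f (h p) ->
  tangent_map Q2 Q3 f (h p) (tangent_map Q1 Q2 h p u) =
  tangent_map Q1 Q3 (f \o h) p u.
Proof.
move=> hp fp; rewrite /tangent_map; apply: diff_chart_comp => //.
- exact: manifold_coord_cancel.
- exact: manifold_coord_cancel.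
- exact: mem_chart_at.
- exact: mem_chart_at.
- exact: mem_chart_at.
Qed.

Lemma tangent_map_id E (Q : manifold E) (p : Q) u :
  tangent_map Q Q id p u = u.
Proof. exact: diff_transition_id (mem_chart_at p). Qed.

(** [velocity] is read in the chart chosen at the current point; this carries a derivative computed
    in a chart [i] over to such a chart [k]. *)
Lemma velocity_chart E (Q : manifold E) (i k : chart Q) (c : R -> Q) (t : R)
    (l : E) :
  dom i (c t) -> dom k (c t) -> (\forall s \near t, dom i (c s)) ->
  is_derive t (1 : R) (coord i \o c) l ->
  is_derive t (1 : R) (coord k \o c)
    ('d (coord k \o param i) (coord i (c t)) l).
Proof.
move=> it kt near_i cl.
apply: (@near_eq_is_derive R R E ((coord k \o param i) \o (coord i \o c))).
  by apply: filterS near_i => s /= ics; rewrite coordK.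
exact: (is_derive_comp_curve cl (is_diff_transition it kt)).
Qed.

(** On the fibres, the differentials of the transitions from the chosen chart to [i] and back
    compose to the identity. *)
Lemma tangent_coord_cancel E (Q : manifold E) :
  coord_cancel (tangent_atlas Q).
Proof.
move=> i [q v] /= iq; rewrite !coordK//; congr (_, _).
have k := mem_chart_at q.
rewrite (diff_transition_comp (A := Q) (h := id))//.
- exact: diff_transition_id.
- exact: manifold_coord_cancel.
- exact: mdifferentiable_id.
Qed.

End Charts.

(** * Noether's identity in a chart *)

Section Slices.
Context {R : realType}.
Implicit Types V W E : normedModType R.

(** The inclusion of the fibre directions, as a linear map that can serve as the [e] of
    [is_derive_dir_curve]. *)
Definition inr_lin V W (w : W) : (V * W)%type := (0, w).

Lemma inr_lin_linear V W : linear (@inr_lin V W).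
Proof.
by move=> k u v; rewrite /inr_lin; congr (_, _); rewrite /= scaler0 addr0.
Qed.

HB.instance Definition _ V W :=
  GRing.isLinear.Build R W (V * W)%type _ (@inr_lin V W) (@inr_lin_linear V W).

Lemma is_diff_slice V W (a : V) (x : W) :
  is_diff x (fun y : W => (a, y)) (@inr_lin V W).
Proof.
have h := is_diff_pair (is_diff_cst a x) (is_diff_id x).
exact: h.
Qed.

Lemma is_diff_comp_slice V W E (f : V * W -> E) (a : V) (x : W) :
  differentiable f (a, x) ->
  is_diff x (fun y => f (a, y)) (fun u => 'D_(0, u) f (a, x)).
Proof.
move=> fd; have h := is_diff_comp (is_diff_slice a x) (differentiableP fd).
suff -> : (fun u => 'D_(0, u) f (a, x)) = 'd f (a, x) \o @inr_lin V W by [].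
by apply/funext => u; rewrite deriveE.
Qed.

Lemma is_derive_pair V W (f : R -> V) (g : R -> W) (t : R) df dg :
  is_derive t (1 : R) f df -> is_derive t (1 : R) g dg ->
  is_derive t (1 : R) (fun s => (f s, g s)) (df, dg).
Proof.
move=> /is_diff_curve fd /is_diff_curve gd.
have h := is_diff_pair fd gd.
apply: DeriveDef; first by apply/derivable1_diffP; exact: ex_diff.
by rewrite (is_diff_derive _ h)/= !scale1r.
Qed.

Lemma is_diff_fst V W (p : V * W) : is_diff p (@fst V W) fst.
Proof.
have c : continuous (@fst V W) by move=> q; exact: cvg_fst.
by apply: DiffDef; [exact: linear_differentiable|exact: diff_lin].
Qed.

Lemma is_diff_snd V W (p : V * W) : is_diff p (@snd V W) snd.
Proof.
have c : continuous (@snd V W) by move=> q; exact: cvg_snd.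
by apply: DiffDef; [exact: linear_differentiable|exact: diff_lin].
Qed.

(* Writing [u = v - y], the derivative differs from the claimed one by the
   action of [d f] on [(y, dy/dx v)]; this vanishes, being the derivative of [f]
   along the orbit of [(x, v)], once the derivatives of [psi] are permuted. *)
Lemma noether_local V n (W : set ('rV[R]_n * 'rV[R]_n)) (U : set (V * 'rV[R]_n))
    (f : 'rV[R]_n * 'rV[R]_n -> R^o) (psi : V * 'rV[R]_n -> 'rV[R]_n)
    (z : R -> 'rV[R]_n * 'rV[R]_n) (t : R) (a : 'rV[R]_n)
    (gam : R -> V) (eta : V)
    (y := fun x => 'D_(eta, 0) psi (gam 0, x)) :
  open W -> W (z t) -> Ck 2 W f ->
  open U -> U (gam 0, (z t).1) -> Ck 2 U psi ->
  is_derive t (1 : R) z ((z t).2, a) ->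
  is_derive (0 : R) (1 : R) gam eta ->
  (\forall x \near (z t).1, psi (gam 0, x) = x) ->
  (\forall s \near (0 : R), f (psi (gam s, (z t).1),
                     'D_(0, (z t).2) psi (gam s, (z t).1)) = f (z t)) ->
  is_derive t (1 : R)
    (fun s => 'D_(0, (z s).2 - y (z s).1) f (z s) - f (z s))
    ('D_((z t).2, a) (fun p => 'D_(0, (z t).2 - y (z t).1) f p) (z t)
     - 'D_((z t).2 - y (z t).1, 0) f (z t)).
Proof.
move=> oW Wz f2 oU Uz psi2 zd gamd psi_id f_inv.
set x0 := (z t).1 in Uz zd psi_id f_inv *.
set v0 := (z t).2 in zd f_inv *.
have xd : is_derive t (1 : R) (fun s => (z s).1) v0.
  exact: (is_derive_comp_curve zd (is_diff_fst (z t))).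
have vd : is_derive t (1 : R) (fun s => (z s).2) a.
  exact: (is_derive_comp_curve zd (is_diff_snd (z t))).
have psid := psi2.1 _ Uz.
pose dy := 'D_(0, v0) (fun p => 'D_(eta, 0) psi p) (gam 0, x0).
have yd : is_derive t (1 : R) (fun s => y (z s).1) dy.
  have psi'd : differentiable (fun p => 'D_(eta, 0) psi p) (gam 0, x0).
    exact: (psi2.2 _).1.
  exact: (is_derive_comp_curve xd (is_diff_comp_slice psi'd)).
have ud : is_derive t (1 : R) (fun s => (z s).2 - y (z s).1) (a - dy).
  exact: is_deriveB.
have near_f : \forall p \near z t, differentiable f p.
  by apply: filterS (open_nbhs_nbhs (conj oW Wz)) => p; exact: f2.1.
have fd := nbhs_singleton near_f.
(* The momentum term: a fibre derivative in the moving direction [v - y], whose own derivative is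
   [a - dy]. *)
have D1 := @is_derive_dir_curve R _ n f (@inr_lin _ _) z _ t _ _ near_f
  (fun v => (f2.2 v).1 _ Wz) zd ud.
have D2 := is_derive_comp_curve zd (differentiableP fd).
have psi0 : psi (gam 0, x0) = x0 by exact: nbhs_singleton psi_id.
have dpsi0 : 'D_(0, v0) psi (gam 0, x0) = v0.
  have h := is_diff_comp_slice psid.
  have h' := near_eq_is_diff psi_id h.
  have h0 : 'D_v0 id x0 = 'D_(0, v0) psi (gam 0, x0).
    exact: is_diff_derive h'.
  exact: (etrans (esym h0) (derive_id x0 v0)).
(* Differentiate the invariance [f_inv] at [s = 0]: the left side follows a curve through [z t] with
   velocity [(y x0, dy)], the right side is constant. *)
have inv0 : 'd f (z t) (y x0, dy) = 0.
  have gx : is_derive (0 : R) (1 : R) (fun s => (gam s, x0)) (eta, 0).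
    exact: is_derive_pair.
  have d1 := is_derive_comp_curve gx (differentiableP psid).
  have d2 := is_derive_comp_curve gx
    (differentiableP ((psi2.2 (0, v0)).1 _ Uz)).
  have d3 := is_derive_pair d1 d2.
  have zE : z t = (psi (gam 0, x0), 'D_(0, v0) psi (gam 0, x0)).
    by rewrite psi0 dpsi0 -surjective_pairing.
  have fdz : is_diff (psi (gam 0, x0), 'D_(0, v0) psi (gam 0, x0)) f
      ('d f (z t)).
    by rewrite -zE; exact: differentiableP.
  have d4 := is_derive_comp_curve d3 fdz.
  have d5 := near_eq_is_derive f_inv d4.
  have -> : y x0 = 'd psi (gam 0, x0) (eta, 0) by rewrite /y deriveE.
  have -> : dy = 'd (fun p => 'D_(0, v0) psi p) (gam 0, x0) (eta, 0).
    apply: etrans (schwarz (0, v0) (eta, 0) oU Uz psi2) _.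
    by apply: deriveE; exact: (psi2.2 _).1.
  have [_ d5E] := d5.
  by apply: etrans (esym d5E) _; exact: derive_cst.
apply: (is_derive_eq (is_deriveB D1 D2)).
(* The velocity splits into [(0, a - dy)], [(v0 - y x0, 0)] and [(y x0, dy)]. The last contributes
   nothing by [inv0], and the first cancels the second term of [D1]. *)
have -> : 'd f (z t) (v0, a) =
    'D_(0, a - dy) f (z t) + 'D_(v0 - y x0, 0) f (z t).
  have -> : (v0, a) = (0, a - dy) + (v0 - y x0, 0) + (y x0, dy).
    congr (_, _) => /=.
      by rewrite add0r subrK.
    by rewrite addr0 subrK.
  by rewrite 2!linearD inv0 addr0 !deriveE.
by rewrite opprD addrA addrK.
Qed.

End Slices.

(** * Lagrangians and actions *)

Section Momentum.
Context {R : realType} {n : nat} (Q : manifold 'rV[R]_n).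
Local Notation E := 'rV[R]_n.
Local Notation coord := Defs.coord.
Variables (L : Q * E -> R) (L_smooth : smooth_lagrangian L).

(** A tangent vector at [q] is stored by its components in [chart_at Q q]; these are its components
    in [i], the fibre part of the bundle coordinates. *)
Definition to_chart (i : chart Q) (q : Q) (u : E) : E :=
  'd (coord i \o param (chart_at Q q)) (coord (chart_at Q q) q) u.

Lemma is_diff_to_chart (i : chart Q) (q : Q) (w : E) :
  dom i q -> is_diff w (to_chart i q) (to_chart i q).
Proof.
move=> iq.
have [cd _] := is_diff_transition (mem_chart_at q) iq.
have c := diff_continuous cd.
by apply: DiffDef; [exact: linear_differentiable|exact: diff_lin].
Qed.

Lemma differentiable_local_lagrangian (i : chart Q) v :
  dom i v.1 -> differentiable (local_lagrangian L i)
                 (@coord _ _ _ (tangent_atlas Q) i v).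
Proof.
move=> iv.
have [_ Ld] := @smooth_at_mdifferentiable R _ _ _ _ (tangent_atlas Q)
  (self_atlas R^o) L v (@L_smooth v) i tt iv Logic.I.
exact: Ld.
Qed.

Lemma local_lagrangianE (i : chart Q) q w :
  dom i q -> local_lagrangian L i (coord i q, to_chart i q w) = L (q, w).
Proof.
move=> iq; congr L.
exact: (@tangent_coord_cancel _ _ Q i (q, w) iq).
Qed.

(** On the fibre over [q], [L] is a slice of its local expression after the linear map
    [to_chart i q]. This identifies [momentum] with [dL/dqdot] in any chart. *)
Lemma is_diff_lagrangian_fibre (i : chart Q) q v : dom i q ->
  is_diff v (fun w => L (q, w) : R^o)
    (fun u => 'D_(0, to_chart i q u) (local_lagrangian L i)
                (coord i q, to_chart i q v)).
Proof.
move=> iq.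
rewrite (_ : (fun w => L (q, w)) =
  (fun y => local_lagrangian L i (coord i q, y)) \o to_chart i q); last first.
  by apply/funext => w /=; rewrite local_lagrangianE.
have ld := @differentiable_local_lagrangian i (q, v) iq.
exact: is_diff_comp (is_diff_to_chart v iq) (is_diff_comp_slice ld).
Qed.

Lemma momentum_chart (i : chart Q) q v u : dom i q ->
  momentum L (q, v) u = 'D_(0, to_chart i q u) (local_lagrangian L i)
                          (coord i q, to_chart i q v).
Proof. by move=> iq; exact: is_diff_derive (is_diff_lagrangian_fibre v iq). Qed.

Lemma momentumB v u u' :
  momentum L v (u - u') = momentum L v u - momentum L v u'.
Proof.
case: v => q v.
have [ld _] := is_diff_lagrangian_fibre v (mem_chart_at q).
by rewrite /momentum !deriveE//= linearB.
Qed.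

Lemma energyB v u :
  energy L v - momentum L v u = momentum L v (v.2 - u) - L v.
Proof. by rewrite momentumB /energy addrAC. Qed.

(** On a fibre the lift is the affine map [w |-> T w + Y]. With [v] the lift of [(q, u)], the
    momentum of the composed Lagrangian on [u] is that of [L] at [v] on [T u], which is [v.2 - Y].
    The range hypothesis makes the pseudo-inverse return a true preimage. *)
Lemma moving_energy_lift (C : Q -> R -> Q) (t : R) (v : Q * E) :
  (forall q, mdifferentiable Q Q (C^~ t) q) ->
  range (time_lift C t) v ->
  moving_energy L C v t =
  energy L v -
  momentum L v (velocity Q (C ('pinv_id setT (time_lift C t) v).1) t).
Proof.
move=> Cd vr; rewrite /moving_energy.
have : time_lift C t ('pinv_id setT (time_lift C t) v) = v.
  by apply: pinvK; rewrite inE.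
case: ('pinv_id setT (time_lift C t) v) => q u <- /=.
set T := tangent_map Q Q (C^~ t) q; set Y := velocity Q (C q) t.
have Td w : is_diff w (fun w => T w + Y) T.
  have c := diff_continuous (Cd q (chart_at Q q) (chart_at Q (C q t))
    (mem_chart_at q) (mem_chart_at (C q t))).2.
  have Tw : is_diff w T T.
    by apply: DiffDef; [exact: linear_differentiable|exact: diff_lin].
  have h := is_diffD Tw (is_diff_cst Y w).
  by rewrite addr0 in h; exact: h.
rewrite /energy /=.
have mE : momentum (L \o time_lift C t) (q, u) u =
    momentum L (time_lift C t (q, u)) (T u).
  have iq := mem_chart_at (C q t).
  have h := is_diff_comp (Td u) (is_diff_lagrangian_fibre (T u + Y) iq).
  rewrite {2}/time_lift/= (momentum_chart _ _ iq).
  exact: is_diff_derive h.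
have := energyB (time_lift C t (q, u)) Y; rewrite /energy => ->.
by rewrite mE /time_lift /= -/T -/Y addrK.
Qed.

End Momentum.

(** * The flow of a one-parameter subgroup and its lift *)

Section Action.
Context {R : realType} {n m : nat} (Q : manifold 'rV[R]_n) (G : lie_group R m).
Variables (Psi : G -> Q -> Q) (Psi_action : is_action Psi).
Variables (exp : 'rV[R]_m -> G) (expP : is_exp exp) (eta : 'rV[R]_m).
Local Notation coord := Defs.coord.
Local Notation Y := (infinitesimal_generator exp Psi eta).

(** The action is smooth jointly in both arguments; freezing the group coordinate at that of [g]
    takes a slice. *)
Lemma action_mdifferentiable g q : mdifferentiable Q Q (Psi g) q.
Proof.
move=> i j iq jq; have [_ _ /(_ (g, q)) Psi_s] := Psi_action.
have [near_psi psid] := smooth_at_mdifferentiable Psi_s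
  (i := (chart_at G g, i)) (j := j) (conj (mem_chart_at g) iq) jq.
split.
  have sl : {for coord i q, continuous
      (fun x : 'rV[R]_n => (coord (chart_at G g) g, x))}.
    apply: differentiable_continuous.
    exact: (@ex_diff _ _ _ _ _ _ _ (is_diff_slice _ _)).
  pose S := @coord _ _ _ (prod_atlas G Q) (chart_at G g, i) @`
    (@dom _ _ _ (prod_atlas G Q) (chart_at G g, i) `&`
     (fun x : G * Q => Psi x.1 x.2) @^-1` dom j).
  have near_x : nbhs (coord i q) [set x | S (coord (chart_at G g) g, x)].
    exact: sl near_psi.
  apply: filterS near_x => x [[g' q'] [[/= gg' iq'] jq'] [gE <-]].
  exists q' => //; split => //.
  (* Equal coordinates in the chart around [g] force [g' = g]. *)
  rewrite /preimage /= in jq'.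
  by rewrite -(coordK gg') gE (coordK (mem_chart_at g)) in jq'.
have -> : coord j \o Psi g \o param i = (fun x =>
    (coord j \o (fun x => Psi x.1 x.2) \o
       @param _ _ _ (prod_atlas G Q) (chart_at G g, i))
     (coord (chart_at G g) g, x)).
  by apply/funext => x /=; rewrite (coordK (mem_chart_at g)).
exact: (@ex_diff _ _ _ _ _ _ _ (is_diff_comp_slice psid)).
Qed.

Lemma exp0 : exp (0 *: eta) = gone G.
Proof. by have [_] := expP eta. Qed.

Lemma exp_flow s t q :
  Psi (exp ((s + t) *: eta)) q = Psi (exp (s *: eta)) (Psi (exp (t *: eta)) q).
Proof.
have [_ _ + _] := expP eta => ->.
by have [_ + _] := Psi_action => ->.
Qed.

(** By the one-parameter group law, shifting time by [t] turns the orbit of [q] into the orbit of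
    the moved point, started at time 0. *)
Lemma velocity_flow t q :
  velocity Q (fun s => Psi (exp (s *: eta)) q) t = Y (Psi (exp (t *: eta)) q).
Proof.
have Psi1 : forall q, Psi (exp (0 *: eta)) q = q.
  by move=> p; rewrite exp0; have [] := Psi_action.
rewrite /infinitesimal_generator /velocity Psi1 derive1_shift.
by congr (derive1 _ 0); apply/funext => s /=; rewrite exp_flow.
Qed.

(** A preimage is found with the inverse group element: remove the velocity of the flow from [w],
    then apply the tangent map of [Psi (ginv g)]. *)
Lemma range_time_lift t (v : Q * 'rV[R]_n) :
  range (time_lift (fun q s => Psi (exp (s *: eta)) q) t) v.
Proof.
case: v => p w; pose g := exp (t *: eta).
have Psi1 : forall q, Psi (gone G) q = q by have [] := Psi_action.
have gK q : Psi g (Psi (ginv g) q) = q.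
  have [_ <- _] := Psi_action.
  (* The group axioms are left-sided, so the right inverse law is derived from them. *)
  have gV : gmul g (ginv g) = gone G.
    have -> : gmul g (ginv g) =
        gmul (gmul (ginv (ginv g)) (ginv g)) (gmul g (ginv g)).
      by rewrite gmulV gmul1.
    by rewrite -gmulA [gmul (ginv g) _]gmulA gmulV gmul1 gmulV.
  by rewrite gV.
pose q := Psi (ginv g) p.
pose w' := w - velocity Q (fun s => Psi (exp (s *: eta)) q) t.
exists (q, tangent_map Q Q (Psi (ginv g)) p w') => //.
rewrite /time_lift /= -/g gK; congr (_, _).
rewrite (@tangent_map_comp _ _ _ _ _ _ _ (Psi (ginv g)) (Psi g) p).
- have -> : Psi g \o Psi (ginv g) = id by apply/funext.
  by rewrite tangent_map_id subrK.
- exact: action_mdifferentiable.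
- exact: action_mdifferentiable.
Qed.

End Action.

(** * The derivative of the moving energy along a motion *)

Section Noether.
Context {R : realType} {n m : nat} (Q : manifold 'rV[R]_n) (G : lie_group R m).
Variables (Psi : G -> Q -> Q) (Psi_action : is_action Psi).
Variables (exp : 'rV[R]_m -> G) (expP : is_exp exp) (eta : 'rV[R]_m).
Local Notation E := 'rV[R]_n.
Local Notation coord := Defs.coord.
Local Notation Y := (infinitesimal_generator exp Psi eta).
Local Notation j := (chart_at G (gone G)).

Definition exp_coord (s : R) : 'rV[R]_m := coord j (exp (s *: eta)).

(** The action near the unit of [G] with the same chart [i] at source and target. It is the [psi] of
    [noether_local], and [exp_coord] is its [gam]. *)
Definition local_action (i : chart Q) : 'rV[R]_m * E -> E :=
  coord i \o (fun x => Psi x.1 x.2) \o @param _ _ _ (prod_atlas G Q) (j, i).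

Lemma near_dom_exp : \forall s \near (0 : R), dom j (exp (s *: eta)).
Proof.
have [gs _ _ _] := expP eta.
have j0 : dom j (exp ((0 : R) *: eta)) by rewrite exp0//; exact: mem_chart_at.
have [near_j _] := @smooth_at_mdifferentiable R _ _ _ _ (self_atlas R^o) G
  (fun s : R^o => exp (s *: eta)) 0 (@gs 0) tt j Logic.I j0.
by apply: filterS near_j => s [s' [_ js'] <-].
Qed.

Lemma is_derive_exp_coord : is_derive (0 : R) (1 : R) exp_coord eta.
Proof.
have [gs g0 _ gv] := expP eta.
have j0 : dom j (exp ((0 : R) *: eta)) by rewrite exp0//; exact: mem_chart_at.
have [_ gd] := @smooth_at_mdifferentiable R _ _ _ _ (self_atlas R^o) G
  (fun s : R^o => exp (s *: eta)) 0 (@gs 0) tt j Logic.I j0.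
apply: DeriveDef; first exact/derivable1_diffP.
by rewrite -derive1E -[RHS]gv /velocity g0.
Qed.

Section LocalAction.
Variables (i : chart Q) (U : set ('rV[R]_m * E)).
Hypotheses (oU : open U)
  (sU : U `<=` @coord _ _ _ (prod_atlas G Q) (j, i) @`
     (@dom _ _ _ (prod_atlas G Q) (j, i) `&`
      (fun x : G * Q => Psi x.1 x.2) @^-1` dom i)).

(** For small [s] the orbit of [q] stays in the chart [i], so a single chart suffices to
    differentiate along it. *)
Lemma near_local_action q : dom i q -> U (exp_coord 0, coord i q) ->
  \forall s \near (0 : R), [/\ dom j (exp (s *: eta)),
    dom i (Psi (exp (s *: eta)) q) & U (exp_coord s, coord i q)].
Proof.
move=> iq Uq.
have gd : is_diff (0 : R) (fun s => (exp_coord s, coord i q)) _ :=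
  is_diff_pair (is_diff_curve is_derive_exp_coord) (is_diff_cst (coord i q) 0).
have gc := differentiable_continuous (@ex_diff _ _ _ _ _ _ _ gd).
have nU : nbhs (exp_coord 0, coord i q) U by exact: open_nbhs_nbhs.
have near_U : \forall s \near (0 : R), U (exp_coord s, coord i q).
  exact: gc nU.
apply: filterS2 near_dom_exp near_U => s js Us; split => //.
have [[g p] [[/= jg ip] ipsi] [gE pE]] := sU Us.
have {}gE : g = exp (s *: eta) by rewrite -(coordK jg) gE /exp_coord coordK.
have {}pE : p = q by rewrite -(coordK ip) pE coordK.
by rewrite /preimage /= gE pE in ipsi.
Qed.

Lemma local_actionE s q : dom j (exp (s *: eta)) -> dom i q ->
  local_action i (exp_coord s, coord i q) = coord i (Psi (exp (s *: eta)) q).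
Proof. by move=> js iq; rewrite /local_action /= /exp_coord !coordK. Qed.

(** Matches [Y] with the [y] of [noether_local]. The orbit is differentiated in [i],
    [velocity_chart] passes to the chosen chart [k], and [to_chart] returns to [i], so the two
    transitions cancel. *)
Lemma to_chart_generator q : dom i q -> U (exp_coord 0, coord i q) ->
  differentiable (local_action i) (exp_coord 0, coord i q) ->
  to_chart i q (Y q) = 'D_(eta, 0) (local_action i) (exp_coord 0, coord i q).
Proof.
move=> iq Uq psid.
have Psi1 : Psi (exp (0 *: eta)) q = q.
  by rewrite exp0//; have [] := Psi_action.
pose k := chart_at Q q; have kq : dom k q := mem_chart_at q.
have near_q := near_local_action iq Uq.
set l := 'D_(eta, 0) _ _.
have cl : is_derive (0 : R) (1 : R)
    (coord i \o (fun s => Psi (exp (s *: eta)) q)) l.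
  have gx := is_derive_pair is_derive_exp_coord
    (is_derive_cst (coord i q) (0 : R) (1 : R)).
  have := is_derive_comp_curve gx (differentiableP psid).
  rewrite -deriveE// -/l; apply: near_eq_is_derive.
  by apply: filterS near_q => s [js _ _] /=; rewrite local_actionE.
have near_i : \forall s \near (0 : R), dom i (Psi (exp (s *: eta)) q).
  by apply: filterS near_q => s [].
have := @velocity_chart R _ Q i k (fun s => Psi (exp (s *: eta)) q) 0 l.
rewrite Psi1 => /(_ iq kq near_i cl) kl.
rewrite /infinitesimal_generator /velocity Psi1 derive1E.
have [_ ->] := kl.
rewrite /to_chart -/k.
rewrite (@diff_transition_comp _ _ _ _ Q Q i k i id q)//.
- exact: diff_transition_id.
- exact: manifold_coord_cancel.
- exact: mdifferentiable_id.
Qed.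

End LocalAction.

Variables (L : Q * E -> R) (L_smooth : smooth_lagrangian L).
Hypothesis L_inv : forall g v, L (tangent_lift Q Q (Psi g) v) = L v.

(** This is [noether_local] in the bundle coordinates of the chart chosen at time [t]. The
    hypothesis on [velocity] is the second-order condition: the base point moves with velocity
    [(c t).2]. *)
Lemma is_derive_moving_energy (c : R -> Q * E) (t : R) :
  smooth_at (self_atlas R^o) (tangent_atlas Q) c t ->
  (velocity (tangent_atlas Q) c t).1 = (c t).2 ->
  is_derive t (1 : R)
    (fun s => energy L (c s) - momentum L (c s) (Y (c s).1))
    (lagrange_expression L (c t) (velocity (tangent_atlas Q) c t)
       ((c t).2 - Y (c t).1)).
Proof.
move=> cs; set a := velocity _ c t => a1.
pose q0 := (c t).1; pose v0 := (c t).2; pose i := chart_at Q q0.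
have iq0 : dom i q0 := mem_chart_at q0.
have Psi1 q : Psi (gone G) q = q by have [] := Psi_action.
have g0 : exp ((0 : R) *: eta) = gone G by exact: exp0.
have [_ _ /(_ (gone G, q0) (j, i) i)] := Psi_action.
rewrite /= Psi1 => /(_ (conj (mem_chart_at _) iq0) iq0).
move=> [U [oU Uq0 sU psi_s]].
have {}Uq0 : U (exp_coord 0, coord i q0) by rewrite /exp_coord g0.
have psi2 : Ck 2 U (local_action i) by exact: psi_s.
have [W [oW Wz _ L2]] := @L_smooth (c t) i tt iq0 Logic.I.
have {}L2 : Ck 2 W (local_lagrangian L i) by exact: L2.
pose z := @coord _ _ _ (tangent_atlas Q) i \o c.
have [near_c zd] := @smooth_at_mdifferentiable R _ _ _ _ (self_atlas R^o)
  (tangent_atlas Q) c t cs tt i Logic.I iq0.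
(* At time [t] the chart [i] is the chosen one, so the fibre coordinate is [v0] itself. *)
have zE : z t = (coord i q0, v0).
  rewrite /z /= -/q0 -/v0 -/i; congr (_, _).
  exact: diff_transition_id.
have zd1 :  is_derive t (1 : R) z ((z t).2, a.2).
  apply: DeriveDef; first exact/derivable1_diffP.
  by rewrite zE /v0 -a1 -surjective_pairing /a /velocity derive1E.
have near_iU : \forall s \near t,
    dom i (c s).1 /\ U (exp_coord 0, (z s).1).
  have zc := differentiable_continuous zd.
  have z1c : {for t, continuous (fun s => (exp_coord 0, (z s).1))}.
    have h := is_diff_comp (differentiableP zd) (is_diff_fst (z t)).
    exact: differentiable_continuous
      (@ex_diff _ _ _ _ _ _ _ (is_diff_pair (is_diff_cst (exp_coord 0) t) h)).
  have nU : nbhs (exp_coord 0, (z t).1) U by rewrite zE; exact: open_nbhs_nbhs.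
  have near_U : \forall s \near t, U (exp_coord 0, (z s).1) by exact: z1c nU.
  by apply: filterS2 near_c near_U => _ [s [_ ic] <-].
(* At nearby times the chosen chart may differ from [i]; the chart formulas for [momentum] and [Y]
   rewrite the moving energy in the fixed chart. *)
have E1 : \forall s \near t,
    'D_(0, (z s).2 - 'D_(eta, 0) (local_action i) (exp_coord 0, (z s).1))
      (local_lagrangian L i) (z s) - local_lagrangian L i (z s)
    = energy L (c s) - momentum L (c s) (Y (c s).1).
  apply: filterS near_iU => s [].
  rewrite /z /=; case: (c s) => q v /= iq Uq.
  rewrite -/(to_chart i q v) (energyB L_smooth) /=; congr (_ - _).
    apply: etrans _ (esym (momentum_chart L_smooth _ _ iq)).
    suff -> : to_chart i q (v - Y q) = to_chart i q v -
      'D_(eta, 0) (local_action i) (exp_coord 0, coord i q) by [].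
    rewrite -(to_chart_generator oU sU iq Uq (psi2.1 _ Uq)).
    exact: linearB.
  exact: local_lagrangianE.
apply: (near_eq_is_derive E1).
have Wzt : W (z t) by exact: Wz.
have Uzt : U (exp_coord 0, (z t).1) by rewrite zE.
have psi_id : \forall x \near (z t).1, local_action i (exp_coord 0, x) = x.
  rewrite zE; apply: filterS (near_param iq0 openT Logic.I) => x [ix xE _].
  by rewrite /local_action /= /exp_coord g0 (coordK (mem_chart_at _)) Psi1.
(* Invariance of [L] read in [i]: the derivative of the local action in the base variable is the
   tangent map of [Psi g] followed by [to_chart]. *)
have L_orbit : \forall s \near (0 : R),
    local_lagrangian L i (local_action i (exp_coord s, (z t).1),
      'D_(0, (z t).2) (local_action i) (exp_coord s, (z t).1))
    = local_lagrangian L i (z t).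
  rewrite zE /=.
  apply: filterS (near_local_action oU sU iq0 Uq0) => s [js is_ Us].
  set g := exp (s *: eta) in js is_ *.
  have gE : param j (exp_coord s) = g by rewrite /exp_coord coordK.
  have dE : 'D_(0, v0) (local_action i) (exp_coord s, coord i q0) =
      to_chart i (Psi g q0) (tangent_map Q Q (Psi g) q0 v0).
    have [_ h] := is_diff_comp_slice (psi2.1 _ Us).
    rewrite /to_chart /tangent_map.
    rewrite (diff_transition_comp (A := Q))//; last 3 first.
    - exact: manifold_coord_cancel.
    - exact: action_mdifferentiable.
    - exact: mem_chart_at.
    have -> : coord i \o Psi g \o param i =
        (fun x => local_action i (exp_coord s, x)).
      by apply/funext => x; rewrite /local_action /= gE.
    by rewrite h.
  have LE : local_lagrangian L i (coord i q0, v0) = L (q0, v0).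
    rewrite -[RHS](local_lagrangianE L v0 iq0).
    by rewrite /to_chart diff_transition_id.
  rewrite (local_actionE js iq0) dE LE.
  apply: etrans (local_lagrangianE L _ is_) _.
  exact: (L_inv g (q0, v0)).
have h := noether_local oW Wzt L2 oU Uzt psi2 zd1 is_derive_exp_coord psi_id
  L_orbit.
apply: (is_derive_eq h).
have uE : (z t).2 - 'D_(eta, 0) (local_action i) (exp_coord 0, (z t).1) =
    v0 - Y q0.
  have := to_chart_generator oU sU iq0 Uq0 (psi2.1 _ Uq0).
  by rewrite zE /= => <-; rewrite /to_chart diff_transition_id.
have aE : ((z t).2, a.2) = a by rewrite zE /v0 -a1 -surjective_pairing.
by rewrite uE aE.
Qed.

End Noether.

(** * Conservation of the moving energy along constrained motions *)

Theorem theorem2 (R : realType) (n r m : nat) (r_gt1 : (1 < r)%N)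
    (r_ltn : (r < n)%N)
    (Q : manifold 'rV[R]_n)
    (L : Q * 'rV[R]_n -> R) (L_smooth : smooth_lagrangian L)
    (L_regular : regular_lagrangian L)
    (D0 : Q -> {vspace 'rV[R]_n}) (D0_distr : smooth_distribution r D0)
    (D0_nonint : ~ integrable_distribution r D0)
    (xi0 : Q -> 'rV[R]_n) (xi0_field : vector_field_on Q setT xi0)
    (xi0_complete : complete_on Q setT xi0)
    (X : Q * 'rV[R]_n -> 'rV[R]_n * 'rV[R]_n)
    (X_field : nonholonomic_vector_field L xi0 D0 X)
    (X_complete : complete_on (tangent_atlas Q) (constraint xi0 D0) X)
    (G : lie_group R m) (exp : 'rV[R]_m -> G) (expP : is_exp exp)
    (Psi : G -> Q -> Q) (Psi_action : is_action Psi)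
    (H1 : forall g v, L (tangent_lift Q Q (Psi g) v) = L v)
    (H2 : forall g q, [set` D0 (Psi g q)] =
                      tangent_map Q Q (Psi g) q @` [set` D0 q])
    (eta : 'rV[R]_m)
    (Y := infinitesimal_generator exp Psi eta)
    (H3 : forall q, Y q - xi0 q \in D0 q)
    (C_eta := fun q (t : R) => Psi (exp (t *: eta)) q)
    (J_eta := fun v : Q * 'rV[R]_n => momentum L v (Y v.1)) :
  (forall v t, moving_energy L C_eta v t = energy L v - J_eta v) /\
  first_integral (tangent_atlas Q) (constraint xi0 D0) X
    (fun v => energy L v - J_eta v).
Proof.
split=> [v t|I c oI Iitv cX].
  have vr := range_time_lift Psi_action exp eta t v.
  have Cd q : mdifferentiable Q Q (C_eta^~ t) q.
    exact: action_mdifferentiable.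
  apply: (etrans (moving_energy_lift L_smooth Cd vr)).
  have vK : time_lift C_eta t ('pinv_id setT (time_lift C_eta t) v) = v.
    by apply: pinvK; rewrite inE.
  (* The velocity of the flow is [Y] at the endpoint, and the endpoint is [v.1] by [vK]. *)
  have vY := velocity_flow Psi_action expP eta t
    ('pinv_id setT (time_lift C_eta t) v).1.
  rewrite vY; congr (_ - momentum _ _ (Y _)).
  exact: (congr1 fst vK).
have [Rf [_ XRf] _] := X_field.
apply: (derive0_itv_cst Iitv) => t It.
have [cs ct vX] := cX t It.
have [Rf0 X1 XL] := XRf _ ct.
have h := @is_derive_moving_energy _ _ _ Q G Psi Psi_action exp expP eta L
  L_smooth H1 c t cs.
rewrite vX in h; have {}h := h X1.
apply: (is_derive_eq h); rewrite XL; apply: Rf0.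
(* The first difference lies in [D0] by the constraint, the second by [H3]; the ideal reaction force
   vanishes on both. *)
have -> : (c t).2 - Y (c t).1 =
    ((c t).2 - xi0 (c t).1) - (Y (c t).1 - xi0 (c t).1).
  by rewrite opprB addrA subrK.
by apply: memvB; [exact: ct|exact: H3].
Qed.
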